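(* Let $(S,P)$ be a $\Gamma$-contraction on a Hilbert space $\mathcal H$ with $P\in C_{\cdot 0}$. Then there is a bounded operator $C_1$ on $\mathcal H$ with $\omega(C_1)\le1$ such that $$S=C_1+C_1^*P.$$
   Context: All Hilbert spaces are complex and separable. Let $\Gamma=\{(z_1+z_2,z_1z_2):|z_1|\le 1,|z_2|\le 1\}\subset\mathbb C^2$. A $\Gamma$-contraction on $\mathcal H$ is a pair $(S,P)$ of commuting bounded operators on $\mathcal H$ such that $\|f(S,P)\|\le\sup_{\Gamma}|f|$ for every polynomial $f$ in two variables. A contraction $P$ is in $C_{\cdot0}$ (is pure) if $P^{*n}\to0$ strongly as $n\to\infty$. The numerical radius of an operator $T$ is $\omega(T)=\sup\{|\langle Tx,x\rangle|:\|x\|\le1\}$. *)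

(* Defs.v *)
(* MathComp / MathComp-Analysis *)
From HB Require Import structures.
From mathcomp Require Import all_boot all_order all_algebra.
From mathcomp Require Import sesquilinear complex.
From mathcomp Require Import all_classical all_reals all_analysis.

Set Implicit Arguments.
Unset Strict Implicit.
Unset Printing Implicit Defensive.

Import Order.TTheory GRing.Theory Num.Theory.
Import numFieldNormedType.Exports.

Local Open Scope classical_set_scope.
Local Open Scope ring_scope.

(* The norm of a module over [R[i]] is valued in [R[i]]; it is a nonnegative
   real there, and [rnorm x] is that real number. *)
Definition rnorm (R : realType) (V : normedZmodType R[i]) (x : V) : R :=
  complex.Re `|x|.

(* Complex Hilbert spaces.  [hdot] is linear in its first argument and
   conjugate-linear in the second. *)
HB.mixin Record CompleteNormedModule_isHilbert (R : realType) H
    of CompleteNormedModule R[i] H := {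
  hdot : {dot H for (@Num.conj R[i])} ;
  hdot_norm : forall x : H, hdot x x = `|x| ^+ 2
}.

#[short(type="hilbertType")]
HB.structure Definition Hilbert (R : realType) :=
  {H of CompleteNormedModule_isHilbert R H & CompleteNormedModule R[i] H}.

Definition separable (T : topologicalType) : Prop :=
  exists D : set T, countable D /\ dense D.

Section Operators.
Variables (R : realType) (H : hilbertType R).

Definition bounded_op (T : H -> H) : Prop :=
  exists M : R, forall x, rnorm (T x) <= M * rnorm x.

Definition opnorm (T : H -> H) : \bar R :=
  ereal_sup [set (rnorm (T x))%:E | x in [set x : H | rnorm x <= 1]].

Definition num_radius (T : H -> H) : \bar R :=
  ereal_sup [set (rnorm (hdot (T x) x))%:E | x in [set x : H | rnorm x <= 1]].

(* For bounded linear [T] the vector [z] exists by the Riesz representation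
   theorem, and it is unique. *)
Definition adjoint (T : H -> H) (y : H) : H :=
  get [set z : H | forall x, hdot (T x) y = hdot x z].

(* [f`_i`_j] is the coefficient of s^i p^j, in accordance with
   [f.[s, p] = f.[s%:P].[p]]. *)
Definition poly2_op (f : {poly {poly R[i]}}) (S P : H -> H) (x : H) : H :=
  \sum_(i < size f) \sum_(j < size f`_i) f`_i`_j *: iter i S (iter j P x).

Definition Gamma : set (R[i] * R[i]) :=
  [set (z.1 + z.2, z.1 * z.2) |
     z in [set z : R[i] * R[i] | rnorm z.1 <= 1 /\ rnorm z.2 <= 1]].

Definition Gamma_contraction (S P : {linear H -> H}) : Prop :=
  [/\ bounded_op S, bounded_op P, (forall x, S (P x) = P (S x)) &
      forall f : {poly {poly R[i]}},
        (opnorm (poly2_op f S P) <=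
         ereal_sup [set (rnorm f.[w.1, w.2])%:E | w in Gamma])%E].

(* The class C_{.0}. *)
Definition pure_contraction (P : {linear H -> H}) : Prop :=
  (opnorm P <= 1)%E /\
  forall x : H, iter n (adjoint P) x @[n --> \oo] --> (0 : H).

End Operators.

(* Main.v *)
Require Import Defs.
From HB Require Import structures.
From mathcomp Require Import all_boot all_order all_algebra.
From mathcomp Require Import sesquilinear complex.
From mathcomp Require Import all_classical all_reals all_analysis.
From mathcomp Require Import ring lra.
Import Order.TTheory GRing.Theory Num.Theory.
Import numFieldNormedType.Exports.
Local Open Scope classical_set_scope.
Local Open Scope ring_scope.

(** An operator C with S = C + C^* P is obtained as a weak limit of explicit
    finite sums.

    For |b| < 1 the rational function (2 b p - s) / (2 - b s) is bounded by 1 on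
    Gamma ([gamma_cayley]), and it is the limit of the polynomials in its
    geometric expansion, so a Gamma-contraction satisfies
    |(2 b P - S) y| <= |(2 - b S) y| ([cayley_contraction]).  Expanding the
    squares for b = r a with |a| = 1 and 0 < r < 1 shows that the pair
    T = r S, Q = r^2 P has the Agler-Young positivity
      |<(T - T^* Q) y, y>| <= |y|^2 - |Q y|^2    ([defect_form_le]).

    If S = C + C^* P, then C - P^* C P = S - S^* P, which suggests the series
    sum_n Q^*^n (T - T^* Q) Q^n.  Its partial sums C_N have numerical radius at
    most 1, because the bounds above telescope to |x|^2 - |Q^N x|^2
    ([truncated_form_le]), and they satisfy
      C_N + C_N^* Q = T - Q^*^N T Q^N    ([truncated_form_eq]),
    where the error tends to 0 in norm since r < 1.  Letting r tend to 1 and N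
    to infinity gives, for every e > 0, a solution up to e
    ([approximate_form]).  The numerical radius bound makes these solutions
    uniformly bounded, so a limit along an ultrafilter exists and solves the
    equation exactly ([limit_form]).

    Everything is expressed through the real bilinear form Re <C x, y> rather
    than through C: no adjoint is then needed before the end, where the Riesz
    representation theorem turns the limit form into an operator
    ([num_form_operator]). *)

Set Implicit Arguments.
Unset Strict Implicit.
Unset Printing Implicit Defensive.

(** * The underlying real inner product *)

Section RealInnerProduct.
Variables (R : realType) (H : hilbertType R).
Implicit Types (x y z w : H) (a : R[i]) (t : R).

Definition rdot x y : R := complex.Re (hdot x y).

Lemma rnormE (V : normedZmodType R[i]) (v : V) : `|v| = ((rnorm v)%:C)%C.
Proof. by rewrite /rnorm RRe_real. Qed.

Lemma rnorm_ge0 (V : normedZmodType R[i]) (v : V) : 0 <= rnorm v.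
Proof. by rewrite -lecR -rnormE normr_ge0. Qed.

Lemma rnormZ (V : normedModType R[i]) a (v : V) :
  rnorm (a *: v) = rnorm a * rnorm v.
Proof. by rewrite {1}/rnorm normrZ !rnormE -rmorphM. Qed.

Lemma rnormD (V : normedZmodType R[i]) (v w : V) :
  rnorm (v + w) <= rnorm v + rnorm w.
Proof. by rewrite -lecR rmorphD /= -!rnormE ler_normD. Qed.

Lemma rnormN (V : normedZmodType R[i]) (v : V) : rnorm (- v) = rnorm v.
Proof. by rewrite /rnorm normrN. Qed.

Lemma rnormM a b : rnorm (a * b) = rnorm a * rnorm b.
Proof. by rewrite {1}/rnorm normrM !rnormE -rmorphM. Qed.

Lemma rnormC t : rnorm (t%:C)%C = `|t|.
Proof. by rewrite /rnorm normc_def /= expr0n /= addr0 sqrtr_sqr. Qed.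

Lemma rdotDl x y z : rdot (x + y) z = rdot x z + rdot y z.
Proof. by rewrite /rdot linearDl /=; move: (hdot x z) (hdot y z) => [? ?] [? ?]. Qed.

Lemma rdotC x y : rdot x y = rdot y x.
Proof.
rewrite /rdot hermC expr0 mul1r -[LHS]/(complex.Re ((hdot y x)^*)%C).
by case: (hdot y x).
Qed.

Lemma rdotDr x y z : rdot z (x + y) = rdot z x + rdot z y.
Proof. by rewrite ![rdot z _]rdotC rdotDl. Qed.

(** Complex linearity of an operator given by a real form is recovered from
    this rule. *)
Lemma rdotZ a x y : rdot (a *: x) y = rdot x ((a^*)%C *: y).
Proof.
rewrite /rdot linearZl_LR linearZr_LR /= -[Num.conj _]/((a^*)^*)%C.
by rewrite conjcK.
Qed.

Lemma rdotZl t x y : rdot (t%:C%C *: x) y = t * rdot x y.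
Proof.
rewrite /rdot linearZl_LR /=.
by case: (hdot x y) => b c /=; rewrite mul0r subr0.
Qed.

Lemma rdotZr t x y : rdot x (t%:C%C *: y) = t * rdot x y.
Proof. by rewrite rdotC rdotZl rdotC. Qed.

Lemma rdotNl x y : rdot (- x) y = - rdot x y.
Proof. by rewrite /rdot linearNl /=; case: (hdot x y). Qed.

Lemma rdotNr x y : rdot x (- y) = - rdot x y.
Proof. by rewrite rdotC rdotNl rdotC. Qed.

Lemma rdotxx x : rdot x x = rnorm x ^+ 2.
Proof. by rewrite /rdot hdot_norm rnormE -rmorphXn. Qed.

Lemma rnormD2 x y :
  rnorm (x + y) ^+ 2 = rnorm x ^+ 2 + 2 * rdot x y + rnorm y ^+ 2.
Proof. by rewrite -!rdotxx rdotDl !rdotDr (rdotC y x); ring. Qed.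

Lemma rnormB2 x y :
  rnorm (x - y) ^+ 2 = rnorm x ^+ 2 - 2 * rdot x y + rnorm y ^+ 2.
Proof. by rewrite rnormD2 rdotNr rnormN; ring. Qed.

(** A form b (x, y) does not change when x is multiplied and y divided by t, so
    a bound by a sum of squares holds for all t at once; the best t, with
    t^2 = q / p, gives the product.  The perturbation d in the proof covers
    p = 0 and q = 0, where this t degenerates. *)
Lemma le_of_scaled (b p q : R) : 0 <= p -> 0 <= q ->
  (forall t, 0 < t -> 2 * b <= (t * p) ^+ 2 + (t^-1 * q) ^+ 2) -> b <= p * q.
Proof.
move=> p0 q0 bpq; apply/ler_addgt0Pr => e e0.
pose d := e / (p + q + 1).
have pq1 : 0 < p + q + 1 by lra.
have d0 : 0 < d by rewrite divr_gt0.
have de : d * (p + q) <= e.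
  by rewrite /d -mulrA -{2}[e]mulr1 ler_pM2l// ler_pdivrMl; lra.
have pd : 0 < p + d by lra.
have qd : 0 < q + d by lra.
have := bpq (Num.sqrt ((q + d) / (p + d))).
rewrite sqrtr_gt0 divr_gt0// => /(_ isT).
rewrite !exprMn exprVn sqr_sqrtr ?divr_ge0 ?(ltW pd) ?(ltW qd)//.
have h1 : (q + d) / (p + d) * p ^+ 2 <= (q + d) * p.
  rewrite -mulrA ler_pM2l// mulrC ler_pdivrMr//; nra.
have h2 : ((q + d) / (p + d))^-1 * q ^+ 2 <= (p + d) * q.
  rewrite invf_div -mulrA ler_pM2l// mulrC ler_pdivrMr//; nra.
by move=> /le_trans/(_ (lerD h1 h2)); lra.
Qed.

Lemma rdot_le x y : rdot x y <= rnorm x * rnorm y.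
Proof.
apply: le_of_scaled (rnorm_ge0 x) (rnorm_ge0 y) _ => t t0.
have := sqr_ge0 (rnorm (t%:C%C *: x - (t^-1)%:C%C *: y)).
rewrite rnormB2 rdotZl rdotZr mulVKf ?gt_eqF//.
by rewrite !rnormZ !rnormC !ger0_norm ?invr_ge0 ?(ltW t0)//; lra.
Qed.

Lemma rdot_inj x y : (forall z, rdot x z = rdot y z) -> x = y.
Proof.
move=> xy; apply/eqP; rewrite -subr_eq0 -normr_eq0 rnormE.
rewrite (_ : rnorm _ = 0)//; apply/eqP.
by rewrite -sqrf_eq0 -rdotxx rdotDl rdotNl xy subrr.
Qed.

End RealInnerProduct.

(** * Riesz representation *)

Section Riesz.
Variables (R : realType) (H : hilbertType R).

Lemma exists_null_seq : exists2 r : nat -> R, forall n, 0 < r n &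
  forall e, 0 < e -> exists N, forall n, (N <= n)%N -> r n < e.
Proof.
exists (fun n => n.+1%:R^-1) => [n|e e0]; first by rewrite invr_gt0.
exists (Num.trunc (e^-1)) => n Nn.
rewrite invf_plt ?posrE ?ltr0n//.
apply: (lt_le_trans (truncnS_gt _)).
by rewrite ler_nat ltnS.
Qed.

Lemma rnorm_cauchy_cvg (u : nat -> H) :
  (forall e : R, 0 < e -> exists N, forall n m, (N <= n)%N -> (N <= m)%N ->
     rnorm (u n - u m) < e) ->
  exists z, forall e : R, 0 < e -> exists N, forall n, (N <= n)%N ->
     rnorm (u n - z) < e.
Proof.
move=> uC.
have uc : cvg (u n @[n --> \oo]).
  apply/cauchy_cvgP/cauchyP => e e0.
  have eE : e = (complex.Re e)%:C%C by rewrite RRe_real// gtr0_real.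
  move: e0; rewrite eE ltcR => e0.
  have [N uN] := uC _ e0.
  exists (u N); exists N => // n /= Nn.
  by rewrite -ball_normE /= rnormE ltcR; exact: uN.
exists (lim (u n @[n --> \oo])) => e e0.
move/cvgrPdistC_lt : uc => /(_ (e%:C)%C); rewrite ltcR => /(_ e0) [N _ uN].
by exists N => n Nn; have := uN n Nn; rewrite /= rnormE ltcR.
Qed.

(** The functional J x = |x|^2 - 2 L x is bounded below, and a minimizing
    sequence is Cauchy by the parallelogram law.  Its limit z is the
    representing vector, because J (z + t w) >= inf J for all real t forces the
    first-order term <z, w> - L w to vanish. *)
Lemma real_riesz (L : H -> R) (M : R) :
  (forall x y, L (x + y) = L x + L y) ->
  (forall t x, L ((t%:C)%C *: x) = t * L x) ->
  (forall x, L x <= M * rnorm x) ->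
  exists z, forall w, rdot z w = L w.
Proof.
move=> LD LZ LM.
pose J (x : H) : R := rnorm x ^+ 2 - 2 * L x.
have Jlb x : - M ^+ 2 <= J x.
  have := LM x; have := sqr_ge0 (rnorm x - M); rewrite /J; nra.
have hJ : has_inf (range J).
  split; first by exists (J 0), 0.
  by exists (- M ^+ 2) => _ [x _ <-].
pose m : R := inf (range J).
have mJ x : m <= J x by apply: ge_inf; [case: hJ|exists x].
have [r r0 rlim] := exists_null_seq.
have /boolp.choice[y yP] : forall n, exists x, J x < m + r n.
  move=> n.
  have [_ [x _ <-] xm] := @inf_adherent _ (range J) (r n) (r0 n) hJ.
  by exists x.
have JD x t w : J (x + (t%:C)%C *: w) =
    J x + 2 * t * (rdot x w - L w) + t ^+ 2 * rnorm w ^+ 2.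
  rewrite /J LD LZ rnormD2 rdotZr rnormZ rnormC exprMn real_normK ?num_real//.
  ring.
have yC n k : rnorm (y n - y k) ^+ 2 <= 2 * (r n + r k).
  have := mJ (y n + ((2^-1)%:C)%C *: (y k - y n)).
  rewrite JD -(rnormN (y k - y n)) opprB.
  have : J (y k) = J (y n + (1%:C)%C *: (y k - y n)).
    by rewrite scale1r addrC subrK.
  rewrite JD -(rnormN (y k - y n)) opprB.
  have := yP n; have := yP k.
  (* J at the midpoint and at the endpoint y k of the segment from y n; d is the
     slope at y n and e the squared length. *)
  have aux (a b d p e f g : R) : a < p + f -> b < p + g ->
      a = b + 2 * 1 * d + 1 ^+ 2 * e ->
      p <= b + 2 * 2^-1 * d + 2^-1 ^+ 2 * e -> e <= 2 * (g + f) by lra.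
  exact: aux.
have [z zP] : exists z, forall e : R, 0 < e -> exists N, forall n, (N <= n)%N ->
     rnorm (y n - z) < e.
  apply: rnorm_cauchy_cvg => e e0.
  have [N NP] := rlim (e ^+ 2 / 4) ltac:(by rewrite divr_gt0 ?exprn_gt0).
  exists N => n k /NP Nn /NP Nk.
  rewrite -(@ltr_pXn2r _ 2)// ?nnegrE ?rnorm_ge0 ?(ltW e0)//.
  by apply: (le_lt_trans (yC n k)); lra.
exists z => w; apply/eqP; rewrite -subr_eq0; apply/eqP.
set d := _ - _.
have dP t : 0 <= t ^+ 2 * rnorm w ^+ 2 + 2 * t * d.
  apply/ler_addgt0Pr => e e0.
  pose c : R := 2 * `|t| * rnorm w + 1.
  have c0 : 0 < c.
    by rewrite /c ltr_wpDl// !mulr_ge0// rnorm_ge0.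
  have [N1 N1P] := zP (e / 2 / c) ltac:(by rewrite !divr_gt0).
  have [N2 N2P] := rlim (e / 2) ltac:(by rewrite divr_gt0).
  pose n := maxn N1 N2.
  have {N1P} := N1P n (leq_maxl _ _).
  have {N2P} := N2P n (leq_maxr _ _).
  rewrite (ltr_pdivlMr _ _ c0) => n2 n1.
  have := mJ (y n + (t%:C)%C *: w); rewrite JD; have := yP n.
  have -> : rdot (y n) w = rdot z w + rdot (y n - z) w.
    by rewrite -rdotDl addrC subrK.
  have b1 : rdot (y n - z) w <= rnorm (y n - z) * rnorm w := rdot_le _ _.
  have b2 : - rdot (y n - z) w <= rnorm (y n - z) * rnorm w.
    by rewrite -rdotNl -(rnormN (y n - z)) rdot_le.
  have b3 : t * rdot (y n - z) w <= `|t| * (rnorm (y n - z) * rnorm w).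
    by apply: (le_trans (ler_norm _)); rewrite normrM ler_wpM2l// ler_norml; lra.
  move: n1; rewrite /c mulrDr mulr1.
  have := rnorm_ge0 (y n - z); rewrite /d; lra.
have A0 := rnorm_ge0 w.
have A1 : 0 < rnorm w ^+ 2 + 1 by rewrite ltr_wpDl// exprn_ge0.
(* The summand 1 avoids a case distinction on w = 0. *)
have := dP (- d / (rnorm w ^+ 2 + 1)).
set q := _ ^+ 2 in A1 *.
have -> : (- d / (q + 1)) ^+ 2 * q + 2 * (- d / (q + 1)) * d =
   - (d ^+ 2 * ((q + 2) / (q + 1) ^+ 2)).
  by field; rewrite gt_eqF.
rewrite oppr_ge0 pmulr_lle0; last by rewrite divr_gt0 ?exprn_gt0//; lra.
by move=> d0; apply/eqP; rewrite -sqrf_eq0 eq_le d0 sqr_ge0.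
Qed.

End Riesz.

(** * A family of functions of modulus at most one on Gamma *)

Section GammaScalar.
Variable R : realType.
Implicit Types (z b s p : R[i]).

Lemma rnorm2E z : rnorm z ^+ 2 = complex.Re z ^+ 2 + complex.Im z ^+ 2.
Proof. by apply: complexI; rewrite add_Re2_Im2 rnormE rmorphXn. Qed.

Lemma rnorm_le2 (V W : normedZmodType R[i]) (v : V) (w : W) :
  (rnorm v <= rnorm w) = (rnorm v ^+ 2 <= rnorm w ^+ 2).
Proof. by rewrite ler_sqr// nnegrE rnorm_ge0. Qed.

(** The difference of the squares is an explicit sum of nonnegative terms.  It
    comes from the convexity of the disc |h - 1| <= |b| |h|, which contains
    h_i = 1 / (1 - b z_i): the bound says that it also contains
    (h_1 + h_2) / 2. *)
Lemma gamma_cayley z1 z2 b : rnorm z1 <= 1 -> rnorm z2 <= 1 -> rnorm b <= 1 ->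
  rnorm (2 * b * (z1 * z2) - (z1 + z2)) <= rnorm (2 - b * (z1 + z2)).
Proof.
move=> z11 z21 b1; rewrite rnorm_le2 -subr_ge0.
have -> : rnorm (2 - b * (z1 + z2)) ^+ 2
          - rnorm (2 * b * (z1 * z2) - (z1 + z2)) ^+ 2 =
    2 * (1 - rnorm z1 ^+ 2) * rnorm (1 - b * z2) ^+ 2
    + 2 * (1 - rnorm z2 ^+ 2) * rnorm (1 - b * z1) ^+ 2
    + (1 - rnorm b ^+ 2) * rnorm (z1 - z2) ^+ 2.
  rewrite !rnorm2E; case: z1 z2 b {z11 z21 b1} => x1 y1 [x2 y2] [u v] /=.
  by ring.
have sq z : rnorm z <= 1 -> 0 <= 1 - rnorm z ^+ 2.
  by move=> z1'; rewrite subr_ge0 expr_le1 ?rnorm_ge0.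
by rewrite !addr_ge0 // ?mulr_ge0 ?sq ?exprn_ge0 ?rnorm_ge0.
Qed.

(** The partial sums of the expansion of (2 b p - s) / (2 - b s) in powers of
    b s / 2, in Horner form: the outer variable is s, the inner one is p. *)
Fixpoint cayley_poly b (N : nat) : {poly {poly R[i]}} :=
  if N is n.+1 then
    ((b / 2)%:P *: cayley_poly b n - (2^-1)%:P%:P) * 'X + ('X * b%:P)%:P
  else 0.

Lemma cayley_polyE b s p N :
  (2 - b * s) * (cayley_poly b N).[s, p] =
  (2 * b * p - s) * (1 - (b * s / 2) ^+ N).
Proof.
elim: N => [|N IH]; first by rewrite /= !horner0 expr0 subrr !mulr0.
rewrite /= !hornerE /=.
move: IH; set c := (cayley_poly b N).[s, p]; rewrite exprS => IH.
rewrite mulrDr.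
have -> : (2 - b * s) * ((b / 2 * c - 2^-1) * s) =
   (b / 2 * ((2 - b * s) * c) - (2 - b * s) / 2) * s by ring.
rewrite IH.
by field.
Qed.

Lemma gamma_sum_le z1 z2 : rnorm z1 <= 1 -> rnorm z2 <= 1 -> rnorm (z1 + z2) <= 2.
Proof. by move=> h1 h2; have := rnormD z1 z2; lra. Qed.

Lemma rnormX z N : rnorm (z ^+ N) = rnorm z ^+ N.
Proof. by rewrite /rnorm normrX rnormE -rmorphXn. Qed.

Lemma rnorm_half z : rnorm (z / 2) = rnorm z / 2.
Proof.
rewrite rnormM (_ : 2^-1 = (2^-1)%:C%C) ?rnormC; first by rewrite ger0_norm.
by rewrite rmorphV ?unitfE// rmorph_nat.
Qed.

Lemma rnorm2 : rnorm (2 : R[i]) = 2.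
Proof. by rewrite /rnorm normr_nat. Qed.

(** The remainder of the geometric expansion costs the summand |b|^N. *)
Lemma cayley_poly_le b s p N : rnorm b < 1 -> Gamma (s, p) ->
  rnorm (cayley_poly b N).[s, p] <= 1 + rnorm b ^+ N.
Proof.
move=> b1 [[z1 z2] /= [h1 h2]] [<- <-] {s p}.
have [s2 q2] := (gamma_sum_le h1 h2, gamma_cayley h1 h2 (ltW b1)).
move: s2 q2; set s := z1 + z2; set p := z1 * z2 => s2 q2.
have bs : rnorm (b * s / 2) <= rnorm b.
  have -> : b * s / 2 = b * (s / 2) by rewrite mulrA.
  rewrite rnormM rnorm_half.
  have := rnorm_ge0 b; have := rnorm_ge0 s; nra.
have d0 : 0 < rnorm (2 - b * s).
  have := rnormD (2 - b * s) (b * s); rewrite subrK rnorm2 rnormM.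
  have := rnorm_ge0 b; have := rnorm_ge0 s; nra.
rewrite -(ler_pM2l d0) -rnormM cayley_polyE rnormM.
apply: ler_pM; rewrite ?rnorm_ge0//.
apply: (le_trans (rnormD _ _)); rewrite rnormN {1}/rnorm normr1 lerD2l rnormX.
by apply: lerXn2r; rewrite ?nnegrE ?rnorm_ge0.
Qed.

End GammaScalar.

(** * Polynomials in two commuting operators *)

Section CoefSum.
Variables (A : nzRingType) (V : zmodType).
Implicit Types (G : nat -> A -> V) (p q : {poly A}).

(** Both sums in [poly2_op] have this shape, the outer one with polynomials as
    coefficients, so additivity and the recursion for Horner form are proved
    once.  All results ask for [G i 0 = 0], which makes the upper summation
    bound irrelevant. *)
Definition coef_sum G p : V := \sum_(i < size p) G i p`_i.

Lemma coef_sum_widen G p n : (forall i, G i 0 = 0) -> (size p <= n)%N ->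
  coef_sum G p = \sum_(i < n) G i p`_i.
Proof.
move=> G0 pn; rewrite /coef_sum (big_ord_widen n (fun i => G i p`_i) pn).
rewrite big_mkcond; apply: eq_bigr => i _; case: ltnP => // /leq_sizeP.
by move/(_ i (leqnn _)) => ->.
Qed.

Lemma coef_sum_cons G p c : (forall i, G i 0 = 0) ->
  coef_sum G (p * 'X + c%:P) = coef_sum (fun i => G i.+1) p + G 0 c.
Proof.
move=> G0; rewrite (@coef_sum_widen _ _ (size p).+1)//; last first.
  by rewrite size_MXaddC; case: ifP.
rewrite big_ord_recl addrC coefD coefMX coefC /= add0r; congr (_ + _).
by apply: eq_bigr => i _; rewrite coefD coefMX coefC /= addr0.
Qed.

Lemma coef_sumD G p q : (forall i, G i 0 = 0) ->
  (forall i, {morph G i : a b / a + b}) ->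
  coef_sum G (p + q) = coef_sum G p + coef_sum G q.
Proof.
move=> G0 GD; pose n := maxn (size p) (size q).
rewrite !(@coef_sum_widen _ _ n) ?leq_maxl ?leq_maxr ?size_polyD//.
by rewrite -big_split; apply: eq_bigr => i _; rewrite coefD GD.
Qed.

Lemma coef_sumZ G k (h : V -> V) p : (forall i, G i 0 = 0) -> h 0 = 0 ->
  {morph h : u v / u + v} -> (forall i a, G i (k * a) = h (G i a)) ->
  coef_sum G (k *: p) = h (coef_sum G p).
Proof.
move=> G0 h0 hD Gk; rewrite (@coef_sum_widen _ _ (size p)) ?size_scale_leq//.
rewrite /coef_sum (big_morph h hD h0).
by apply: eq_bigr => i _; rewrite coefZ Gk.
Qed.

End CoefSum.

Section OperatorPolynomials.
Variables (R : realType) (H : hilbertType R) (S P : {linear H -> H}).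
Hypothesis SP : forall x, S (P x) = P (S x).
Implicit Types (f g : {poly {poly R[i]}}) (c b : R[i]) (x y : H).

Let G x i j (a : R[i]) : H := a *: iter i S (iter j P x).

Lemma poly2_opE f x :
  poly2_op f S P x = coef_sum (fun i => coef_sum (G x i)) f.
Proof. by []. Qed.

Let G0 x i j : G x i j 0 = 0. Proof. exact: scale0r. Qed.
Let GD x i j : {morph G x i j : a b / a + b}.
Proof. by move=> a b; rewrite /G scalerDl. Qed.
Let CG0 x i : coef_sum (G x i) 0 = 0.
Proof. by rewrite /coef_sum size_poly0 big_ord0. Qed.

Lemma poly2_opD f g x :
  poly2_op (f + g) S P x = poly2_op f S P x + poly2_op g S P x.
Proof. by rewrite !poly2_opE coef_sumD// => i p q; rewrite coef_sumD. Qed.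

Lemma poly2_opZ c f x : poly2_op (c%:P *: f) S P x = c *: poly2_op f S P x.
Proof.
rewrite !poly2_opE; apply: coef_sumZ; rewrite ?scaler0//; first exact: scalerDr.
move=> i p; rewrite mul_polyC; apply: coef_sumZ; rewrite ?scaler0//.
  exact: scalerDr.
by move=> j a; rewrite /G scalerA.
Qed.

Lemma poly2_op_cons f (p : {poly R[i]}) x :
  poly2_op (f * 'X + p%:P) S P x = S (poly2_op f S P x) + coef_sum (G x 0) p.
Proof.
rewrite !poly2_opE coef_sum_cons//; congr (_ + _).
rewrite /coef_sum linear_sum; apply: eq_bigr => i _.
by rewrite linear_sum; apply: eq_bigr => j _; rewrite /G linearZ.
Qed.

Lemma coef_sumC x c : coef_sum (G x 0) c%:P = c *: x.
Proof.
have := @coef_sum_cons _ _ (G x 0) 0 c (G0 x 0).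
by rewrite mul0r add0r => ->; rewrite /coef_sum size_poly0 big_ord0 add0r.
Qed.

Lemma poly2_opC c x : poly2_op c%:P%:P S P x = c *: x.
Proof.
have := poly2_op_cons 0 c%:P x; rewrite mul0r add0r => ->.
by rewrite coef_sumC {1}/poly2_op size_poly0 big_ord0 linear0 add0r.
Qed.

Lemma poly2_opX x : poly2_op 'X S P x = S x.
Proof.
have := poly2_op_cons 1%:P%:P 0 x; rewrite addr0 mul1r => ->.
by rewrite poly2_opC scale1r /coef_sum size_poly0 big_ord0 addr0.
Qed.

Lemma hdot_inj x y : (forall z, hdot x z = hdot y z) -> x = y.
Proof. by move=> xy; apply: rdot_inj => z; rewrite /rdot xy. Qed.

(** The polynomial is evaluated on the range of 2 - b S, where the denominator
    cancels; so 2 - b S never has to be inverted. *)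
Lemma cayley_op b N y :
  let w := y - (b / 2) ^+ N *: iter N S y in
  poly2_op (cayley_poly b N) S P (2%:R *: y - b *: S y) =
  (2 * b) *: P w - S w.
Proof.
elim: N => [|N IH] /=.
  by rewrite /poly2_op size_poly0 big_ord0 expr0 scale1r subrr !linear0 addr0.
rewrite poly2_op_cons -polyCN -polyCN poly2_opD poly2_opZ poly2_opC {}IH.
have -> : 'X * b%:P = b%:P * 'X + 0%:P :> {poly R[i]} by rewrite addr0 mulrC.
rewrite coef_sum_cons// (_ : coef_sum _ _ = b *: P (2%:R *: y - b *: S y)); last first.
  have := @coef_sum_cons _ _ (fun j => G (2%:R *: y - b *: S y) 0 j.+1) 0 b.
  rewrite mul0r add0r => -> //.
  by rewrite /coef_sum size_poly0 big_ord0 add0r.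
rewrite /G scale0r addr0.
(* Pairing with z turns the identity of vectors into one of scalars. *)
apply: hdot_inj => z.
rewrite !(linearB, linearD, linearZ, linearN, SP) /=.
rewrite !(linearBl, linearDl, linearZl_LR, linearNl) /=.
by rewrite exprS /GRing.scale /=; field.
Qed.

End OperatorPolynomials.

(** * The von Neumann type inequality *)

Lemma exists_expr_lt (R : realType) (q e : R) : 0 <= q -> q < 1 -> 0 < e ->
  exists N, q ^+ N < e.
Proof.
move=> q0 q1 e0.
have : q ^+ n @[n --> \oo] --> (0 : R) by apply: cvg_expr; rewrite ger0_norm.
move/cvgrPdistC_lt => /(_ e e0) [N _ /(_ N (leqnn N))] /=.
by rewrite subr0 ger0_norm ?exprn_ge0// => qe; exists N.
Qed.

Lemma le_of_geometric (R : realType) (a b c q : R) : 0 <= q -> q < 1 -> 0 <= c ->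
  (forall N, a <= b + c * q ^+ N) -> a <= b.
Proof.
move=> q0 q1 c0 ab; apply/ler_addgt0Pr => e e0.
have c1 : 0 < c + 1 by lra.
have [N] := exists_expr_lt q0 q1 (divr_gt0 e0 c1).
rewrite ltr_pdivlMr// => qN; apply: (le_trans (ab N)); rewrite lerD2l.
by have := exprn_ge0 N q0; lra.
Qed.

Section VonNeumann.
Variables (R : realType) (H : hilbertType R) (S P : {linear H -> H}).
Implicit Types (x y : H) (b : R[i]).

Lemma rnorm_eq0 x : rnorm x = 0 -> x = 0.
Proof. by move=> x0; apply/eqP; rewrite -normr_eq0 rnormE x0. Qed.

Lemma opnorm_le (T : H -> H) (M : R) :
  (forall a x, T (a *: x) = a *: T x) -> (opnorm T <= M%:E)%E ->
  forall x, rnorm (T x) <= M * rnorm x.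
Proof.
move=> TZ TM x; have [/rnorm_eq0 ->|x0] := eqVneq (rnorm x) 0.
  by rewrite -(scale0r 0) TZ !rnormZ rnormC normr0 !mul0r mulr0.
have xp : 0 < rnorm x by rewrite lt_neqAle eq_sym x0 rnorm_ge0.
have : ((rnorm (T (((rnorm x)^-1)%:C%C *: x)))%:E <= opnorm T)%E.
  apply: ereal_sup_ubound; exists (((rnorm x)^-1)%:C%C *: x) => //=.
  by rewrite rnormZ rnormC ger0_norm ?invr_ge0 ?rnorm_ge0// mulVf.
move/le_trans => /(_ _ TM).
by rewrite lee_fin TZ rnormZ rnormC ger0_norm ?invr_ge0 ?rnorm_ge0// ler_pdivrMl// mulrC.
Qed.

Lemma iterZ (T : {linear H -> H}) n a x : iter n T (a *: x) = a *: iter n T x.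
Proof. by elim: n => //= n ->; rewrite linearZ. Qed.

Lemma poly2_op_scalable f a x : poly2_op f S P (a *: x) = a *: poly2_op f S P x.
Proof.
rewrite /poly2_op scaler_sumr; apply: eq_bigr => i _.
rewrite scaler_sumr; apply: eq_bigr => j _.
by rewrite !iterZ !scalerA mulrC.
Qed.

Hypothesis SP : Gamma_contraction S P.

Lemma gamma_contraction_le f (M : R) :
  (forall s p, Gamma (s, p) -> rnorm f.[s, p] <= M) ->
  forall x, rnorm (poly2_op f S P x) <= M * rnorm x.
Proof.
move=> fM; apply: opnorm_le; first exact: poly2_op_scalable.
case: SP => _ _ _ /(_ f) /le_trans; apply.
by apply: ge_ereal_sup => _ [[s p] /= sp <-]; rewrite lee_fin fM.
Qed.

Lemma gamma_contraction_S x : rnorm (S x) <= 2 * rnorm x.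
Proof.
rewrite -(poly2_opX S P); apply: gamma_contraction_le => s p [[z1 z2] /= [h1 h2]].
by move=> [<- _]; rewrite hornerX hornerC gamma_sum_le.
Qed.

Hypothesis P1 : forall x, rnorm (P x) <= rnorm x.

Lemma iter_S_le n x : rnorm (iter n S x) <= 2 ^+ n * rnorm x.
Proof.
elim: n => [|n IH] /=; first by rewrite mul1r.
apply: (le_trans (gamma_contraction_S _)).
by rewrite exprS -mulrA ler_pM2l.
Qed.

(** Let N tend to infinity in the inequality for [cayley_poly b N] at the vector
    2 y - b S y: both the remainder |b|^N and the tail u, whose norm is at most
    |b|^N |y|, disappear. *)
Lemma cayley_contraction b y : rnorm b < 1 ->
  rnorm ((2 * b) *: P y - S y) <= rnorm (2%:R *: y - b *: S y).
Proof.
move=> b1; set v := 2%:R *: y - b *: S y.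
have c0 : 0 <= rnorm v + 4 * rnorm y.
  by rewrite addr_ge0 ?mulr_ge0 ?rnorm_ge0.
have SPc : forall x, S (P x) = P (S x) by case: SP.
apply: (@le_of_geometric R _ _ _ _ (rnorm_ge0 b) b1 c0) => N.
pose u : H := (b / 2) ^+ N *: iter N S y.
have u_le : rnorm u <= rnorm b ^+ N * rnorm y.
  rewrite /u rnormZ rnormX rnorm_half expr_div_n -mulrA.
  rewrite ler_wpM2l ?exprn_ge0 ?rnorm_ge0//.
  by rewrite ler_pdivrMl ?exprn_gt0 ?iter_S_le.
have h1 : rnorm ((2 * b) *: P (y - u) - S (y - u)) <= (1 + rnorm b ^+ N) * rnorm v.
  rewrite -(cayley_op SPc b N y); apply: gamma_contraction_le => s p.
  exact: cayley_poly_le.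
have h2 : rnorm ((2 * b) *: P u - S u) <= 4 * rnorm u.
  apply: (le_trans (rnormD _ _)); rewrite rnormN rnormZ rnormM rnorm2.
  have := gamma_contraction_S u; have := P1 u; have := rnorm_ge0 (P u).
  by have := rnorm_ge0 b; nra.
have -> : (2 * b) *: P y - S y =
    ((2 * b) *: P (y - u) - S (y - u)) + ((2 * b) *: P u - S u).
  by rewrite addrACA -opprD -scalerDr -!linearD subrK.
apply: (le_trans (rnormD _ _)); have := exprn_ge0 N (rnorm_ge0 b).
have := rnorm_ge0 y; have := rnorm_ge0 v; nra.
Qed.

End VonNeumann.

(** * Forms of numerical radius at most one *)

Section NumericalForms.
Variables (R : realType) (H : hilbertType R).
Implicit Types (x y : H) (B : H -> H -> R).

(** These are the real parts of the sesquilinear forms <C x, y> with numerical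
    radius of C at most 1: with additivity, the fourth condition says that the
    form is sesquilinear, and the last one bounds Re (a <C x, x>) for every unimodular a, hence
    |<C x, x>|. *)
Definition num_form B : Prop :=
  [/\ forall x y z, B (x + y) z = B x z + B y z,
      forall x y z, B z (x + y) = B z x + B z y,
      forall (t : R) x y, B (t%:C%C *: x) y = t * B x y,
      forall (a : R[i]) x y, B (a *: x) y = B x ((a^*)%C *: y) &
      forall (a : R[i]) x, rnorm a = 1 -> B (a *: x) x <= rnorm x ^+ 2].

Lemma num_formZr B (t : R) x y : num_form B -> B x (t%:C%C *: y) = t * B x y.
Proof. by move=> [_ _ BR BZ _]; rewrite -(conjc_real t) -BZ BR. Qed.

Lemma num_formN B x y : num_form B -> B (- x) y = - B x y.
Proof.
move=> [_ _ BR _ _]; rewrite -[LHS](_ : B ((-1)%:C%C *: x) y = _).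
  by rewrite BR mulN1r.
by rewrite rmorphN rmorph1 scaleN1r.
Qed.

Lemma num_formNr B x y : num_form B -> B x (- y) = - B x y.
Proof.
move=> Bn; rewrite -[LHS](_ : B x ((-1)%:C%C *: y) = _).
  by rewrite num_formZr// mulN1r.
by rewrite rmorphN rmorph1 scaleN1r.
Qed.

(** Polarization: 4 B x y is the sum over k < 4 of the values of B at
    (i^k (x + i^k y), x + i^k y), each at most |x + i^k y|^2. *)
Lemma num_form_ub B x y : num_form B -> B x y <= rnorm x ^+ 2 + rnorm y ^+ 2.
Proof.
move=> Bn; have [BDl BDr BR BZ B1] := Bn.
pose j : R[i] := 'i%C; pose y' := j *: y.
have jj (v : H) : j *: (j *: v) = - v by rewrite scalerA -expr2 sqr_i scaleN1r.
have jc : (j^*)%C = - j by rewrite /j /=; apply/eqP; rewrite eq_complex /= oppr0 !eqxx.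
have j1 : rnorm j = 1.
  by rewrite /rnorm normc_def /= expr0n expr1n /= add0r sqrtr1.
have jN1 : rnorm (- j) = 1 by rewrite rnormN.
have k1 : rnorm (1 : R[i]) = 1 by rewrite /rnorm normr1.
have kN1 : rnorm (- 1 : R[i]) = 1 by rewrite rnormN.
have Bj u v : B (j *: u) (j *: v) = B u v.
  by rewrite BZ jc scaleNr jj opprK.
have h0 := B1 1 (x + y) k1; have h2 := B1 (-1) (x - y) kN1.
have h1 := B1 j (x + y') j1; have h3 := B1 (- j) (x - y') jN1.
have e1 : rnorm (x + y') ^+ 2 + rnorm (x - y') ^+ 2 = 2 * rnorm x ^+ 2 + 2 * rnorm y ^+ 2.
  by rewrite rnormD2 rnormB2 rnormZ j1 mul1r; ring.
have e2 : rnorm (x + y) ^+ 2 + rnorm (x - y) ^+ 2 = 2 * rnorm x ^+ 2 + 2 * rnorm y ^+ 2.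
  by rewrite rnormD2 rnormB2; ring.
move: h0 h2; rewrite scale1r scaleN1r !(BDl, BDr, num_formN, num_formNr)//.
move: h1 h3; rewrite scaleNr /y' scalerDr scalerBr jj.
rewrite !(BDl, BDr, num_formN, num_formNr, Bj)// -/y'.
lra.
Qed.

Lemma num_form_abs B x y : num_form B -> `|B x y| <= rnorm x ^+ 2 + rnorm y ^+ 2.
Proof.
move=> Bn; rewrite ler_norml num_form_ub// andbT lerNl -num_formN//.
by rewrite -(rnormN x) num_form_ub.
Qed.

End NumericalForms.

(** * Approximate solutions *)

Section TruncatedForms.
Variables (R : realType) (H : hilbertType R) (S P : {linear H -> H}).
Hypothesis SP : Gamma_contraction S P.
Hypothesis P1 : forall x, rnorm (P x) <= rnorm x.
Implicit Types (x y : H).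

(** Re <(T - T^* Q) x, y> for T = r S and Q = r^2 P. *)
Definition defect_form (r : R) x y : R :=
  r * rdot (S x) y - r ^+ 3 * rdot (P x) (S y).

(** Re <C_N x, y> for C_N = sum_(n < N) Q^*^n (T - T^* Q) Q^n. *)
Definition truncated_form (r : R) N x y : R :=
  \sum_(n < N) (r ^+ 4) ^+ n * defect_form r (iter n P x) (iter n P y).

(** As rewrite rules, [linearD] and [linearZ] would also match the products with
    a scalar, which are linear maps as well. *)
Lemma opD (T : {linear H -> H}) x y : T (x + y) = T x + T y.
Proof. exact: linearD. Qed.

Lemma opZ (T : {linear H -> H}) (a : R[i]) x : T (a *: x) = a *: T x.
Proof. exact: linearZ. Qed.

(** Expand the squares of [cayley_contraction] for b = r a, after multiplying
    the smaller side by r^2 <= 1: the terms |S y|^2 then cancel. *)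
Lemma defect_form_le (r : R) (a : R[i]) y : 0 < r -> r < 1 -> rnorm a = 1 ->
  defect_form r (a *: y) y <= rnorm y ^+ 2 - r ^+ 4 * rnorm (P y) ^+ 2.
Proof.
move=> r0 r1 a1.
have ra1 : rnorm (r%:C%C * a) < 1 by rewrite rnormM a1 rnormC ger0_norm ?mulr1// ltW.
have r2 : r ^+ 2 <= 1 by rewrite expr_le1 ?(ltW r0) ?(ltW r1).
have /(_ y) := @cayley_contraction _ _ _ _ SP P1 _ ^~ ra1.
rewrite rnorm_le2 => /(le_trans (ler_piMl (sqr_ge0 _) r2)); rewrite !rnormB2.
have -> : 2 * (r%:C%C * a) = ((2 * r)%:C)%C * a by rewrite rmorphM rmorph_nat mulrA.
have -> : 2%:R *: y = (2%:C)%C *: y by rewrite rmorph_nat.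
rewrite -!scalerA !rdotZl !rdotZr !rnormZ a1 !rnormC mul1r.
rewrite (ger0_norm (ltW r0)) (ger0_norm (ler0n _ 2)) ger0_norm ?mulr_ge0 ?(ltW r0)//.
by rewrite /defect_form !opZ (rdotC y); lra.
Qed.

Lemma iterDl (T : {linear H -> H}) n x y : iter n T (x + y) = iter n T x + iter n T y.
Proof. by elim: n => //= n ->; rewrite linearD. Qed.

Lemma truncated_form_le (r : R) N (a : R[i]) x : 0 < r -> r < 1 -> rnorm a = 1 ->
  truncated_form r N (a *: x) x <=
  rnorm x ^+ 2 - (r ^+ 4) ^+ N * rnorm (iter N P x) ^+ 2.
Proof.
move=> r0 r1 a1; rewrite /truncated_form; elim: N => [|N IH].
  by rewrite big_ord0 mul1r subrr.
rewrite big_ord_recr /= iterZ.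
have := defect_form_le (iter N P x) r0 r1 a1.
rewrite -(ler_pM2l (_ : 0 < (r ^+ 4) ^+ N)) ?exprn_gt0// => h.
apply: (le_trans (lerD IH h)).
by rewrite mulrBr [_ ^+ N.+1]exprSr; lra.
Qed.

Lemma truncated_form_num (r : R) N : 0 < r -> r < 1 -> num_form (truncated_form r N).
Proof.
move=> r0 r1; rewrite /truncated_form; split=> [x y z|x y z|t x y|a x y|a x a1].
- rewrite -big_split /=; apply: eq_bigr => i _.
  by rewrite /defect_form !iterDl !opD !rdotDl; ring.
- rewrite -big_split /=; apply: eq_bigr => i _.
  by rewrite /defect_form !iterDl !opD !rdotDr; ring.
- rewrite mulr_sumr; apply: eq_bigr => i _.
  by rewrite /defect_form !iterZ !opZ !rdotZl; ring.
- apply: eq_bigr => i _.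
  by rewrite /defect_form !iterZ !opZ !rdotZ.
- apply: (le_trans (truncated_form_le N x r0 r1 a1)).
  by rewrite gerBl mulr_ge0 ?exprn_ge0 ?rnorm_ge0 ?(ltW r0).
Qed.

(** In operator form: C_N + C_N^* Q = T - Q^*^N T Q^N.  The n-th summands add up
    to a difference of consecutive terms Re <T Q^n x, Q^n y>. *)
Lemma truncated_form_eq (r : R) N x y :
  truncated_form r N x y + r ^+ 2 * truncated_form r N y (P x) =
  r * rdot (S x) y - (r ^+ 4) ^+ N * (r * rdot (S (iter N P x)) (iter N P y)).
Proof.
rewrite /truncated_form mulr_sumr -big_split /=; elim: N => [|N IH].
  by rewrite big_ord0 expr0 mul1r subrr.
rewrite big_ord_recr /= {}IH /defect_form -iterSr /=.
rewrite (rdotC (S (iter N P y))) [_ ^+ N.+1]exprS (rdotC (P (iter N P y))); ring.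
Qed.

Lemma rnorm_iterP n x : rnorm (iter n P x) <= rnorm x.
Proof. by elim: n => //= n; exact: le_trans (P1 _). Qed.

Lemma rdotS_le x y : `|rdot (S x) y| <= rnorm x ^+ 2 + rnorm y ^+ 2.
Proof.
have aux u : rdot (S u) y <= rnorm u ^+ 2 + rnorm y ^+ 2.
  have := rdot_le (S u) y; have := gamma_contraction_S SP u.
  have := rnorm_ge0 y; have := sqr_ge0 (rnorm u - rnorm y); nra.
by rewrite ler_norml aux lerNl -rdotNl -linearN -(rnormN x) aux.
Qed.

(** The equation for [truncated_form] deviates from the one wanted here by the
    factors r and r^2 and by the telescoping remainder; these contribute
    (1 - r) + (1 - r^2) <= 3 (1 - r) and (r^4)^N. *)
Lemma approximate_form (e : R) : 0 < e -> exists2 B, num_form B &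
  forall x y, `|B x y + B y (P x) - rdot (S x) y| <= e * (rnorm x ^+ 2 + rnorm y ^+ 2).
Proof.
move=> e0.
have [r [r0 r1 re]] : exists r : R, [/\ 0 < r, r < 1 & 3 * (1 - r) <= e / 2].
  exists (1 - Num.min (2^-1) (e / 6)); have e6 : 0 < e / 6 by rewrite divr_gt0.
  by case: (leP (2^-1) (e / 6)) => h; split; lra.
have q0 : 0 <= r ^+ 4 by rewrite exprn_ge0 ?(ltW r0).
have q1 : r ^+ 4 < 1 by rewrite exprn_ilt1 ?(ltW r0).
have [N rN] := exists_expr_lt q0 q1 (ltac:(by rewrite divr_gt0) : 0 < e / 2).
have Bn := truncated_form_num N r0 r1.
exists (truncated_form r N) => // x y.
set Z := rnorm x ^+ 2 + rnorm y ^+ 2.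
have Pn n z : rnorm (iter n P z) ^+ 2 <= rnorm z ^+ 2.
  by rewrite -rnorm_le2 rnorm_iterP.
have b1 : `|truncated_form r N y (P x)| <= Z.
  apply: (le_trans (num_form_abs _ _ Bn)).
  by rewrite /Z addrC lerD2r -rnorm_le2.
have s1 : `|rdot (S x) y| <= Z by exact: rdotS_le.
have s2 : `|rdot (S (iter N P x)) (iter N P y)| <= Z.
  by apply: (le_trans (rdotS_le _ _)); rewrite lerD.
have Z0 : 0 <= Z by rewrite addr_ge0 ?sqr_ge0.
have q2 := exprn_ge0 N q0.
have r2 : r ^+ 2 <= 1 by rewrite expr_le1 ?(ltW r0) ?(ltW r1).
have -> : truncated_form r N x y + truncated_form r N y (P x) - rdot (S x) y =
   (1 - r ^+ 2) * truncated_form r N y (P x) - (1 - r) * rdot (S x) y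
   - (r ^+ 4) ^+ N * r * rdot (S (iter N P x)) (iter N P y).
  by have := truncated_form_eq r N x y; lra.
have cZ (c t : R) : 0 <= c -> `|t| <= Z -> `|c * t| <= c * Z.
  by move=> c0 tZ; rewrite normrM ger0_norm// ler_wpM2l.
have := cZ (1 - r ^+ 2) _ ltac:(by rewrite subr_ge0) b1.
have := cZ (1 - r) _ ltac:(by rewrite subr_ge0 ltW) s1.
have := cZ ((r ^+ 4) ^+ N * r) _ ltac:(by rewrite mulr_ge0 ?(ltW r0)) s2.
move=> h1 h2 h3; apply: (le_trans (ler_normB _ _)).
apply: (le_trans (lerD (ler_normB _ _) (lexx _))).
apply: (le_trans (lerD (lerD h3 h2) h1)).
rewrite -!mulrDl ler_wpM2r//.
move: rN q2; move: ((r ^+ 4) ^+ N) => q qe q2; nra.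
Qed.

End TruncatedForms.

(** * Passage to the limit *)

Section GeneralizedLimit.
Variable R : realType.
Implicit Types (u v : nat -> R) (c M : R).

Definition bounded_seq u := exists M, forall n, `|u n| <= M.

(** The limit along an ultrafilter that refines the filter of cofinite sets:
    bounded sequences converge along it since intervals are compact. *)
Lemma generalized_limit : exists glim : (nat -> R) -> R,
  [/\ forall u v, bounded_seq u -> bounded_seq v ->
        glim (fun n => u n + v n) = glim u + glim v,
      forall c u, bounded_seq u -> glim (fun n => c * u n) = c * glim u,
      forall u c, bounded_seq u -> (forall n, u n <= c) -> glim u <= c &
      forall u c, u n @[n --> \oo] --> c -> glim u = c].
Proof.
have [U [UU Uoo]] := @ultraFilterLemma nat \oo _.
have UP : ProperFilter U by exact: ultra_proper.
have Ucvg u : bounded_seq u -> cvg (u n @[n --> U]).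
  move=> [M uM]; have FP : ProperFilter (u n @[n --> U]) by exact: fmap_proper_filter.
  have [|p [_ Fp]] := @segment_compact R (- M) M (u n @[n --> U]) FP.
    apply: (@filterE _ U) => n; rewrite /= in_itv /= -ler_norml; exact: uM.
  apply/cvg_ex; exists p => A pA /=.
  have [//|nA] := in_ultra_setVsetC (u @^-1` A) UU.
  by have [x [? ?]] := Fp (~` A) A nA pA.
exists (fun u => lim (u n @[n --> U])); split=> [u v|c u|u c|u c].
- by move=> /Ucvg uc /Ucvg vc; apply/cvg_lim => //; exact: cvgD.
- by move=> /Ucvg uc; apply/cvg_lim => //; exact: (cvgM (cvg_cst c) uc).
- by move=> /Ucvg uc ucle; apply: limr_le => //; exact: filterE.
- move=> uc; apply/cvg_lim => //; apply: cvg_trans uc; exact: cvg_app.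
Qed.

End GeneralizedLimit.

Section FormOperators.
Variables (R : realType) (H : hilbertType R).
Implicit Types (x y : H) (L : H -> H -> R).

(** [num_form_ub] for the pair (t x, t^-1 y), optimized over t. *)
Lemma num_form_le L x y : num_form L -> L x y <= 2 * rnorm x * rnorm y.
Proof.
move=> Ln; have [_ _ LR _ _] := Ln.
suff : L x y / 2 <= rnorm x * rnorm y by lra.
apply: le_of_scaled (rnorm_ge0 x) (rnorm_ge0 y) _ => t t0.
have := num_form_ub (t%:C%C *: x) ((t^-1)%:C%C *: y) Ln.
rewrite LR num_formZr// mulVKf ?gt_eqF// !rnormZ !rnormC.
by rewrite !ger0_norm ?invr_ge0 ?(ltW t0)//; lra.
Qed.

(** Uniqueness of the representing vector makes C linear.  For the numerical
    radius, rotate <C x, x> onto the positive axis by the unimodular scalar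
    a = |h| / h. *)
Lemma num_form_operator L : num_form L ->
  exists2 C : {linear H -> H}, forall x y, rdot (C x) y = L x y &
    bounded_op C /\ (num_radius C <= 1)%E.
Proof.
move=> Ln; have [LDl LDr LR LZ L1] := Ln.
have /boolp.choice[C CL] : forall x, exists z, forall y, rdot z y = L x y.
  move=> x; apply: (@real_riesz _ _ (L x) (2 * rnorm x)) => [y z|t y|y].
  - exact: LDr.
  - exact: num_formZr.
  - exact: num_form_le.
have Clin : linear C.
  move=> a x y; apply: rdot_inj => z.
  by rewrite rdotDl rdotZ !CL LDl LZ.
pose C1 : {linear H -> H} := HB.pack C (GRing.isLinear.Build _ _ _ _ C Clin).
exists C1 => //; split.
  exists 2 => x; have := num_form_le x (C x) Ln.
  rewrite -CL rdotxx; have := rnorm_ge0 (C x); rewrite le_eqVlt => /predU1P[|C0].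
    by move=> <- _; rewrite mulr_ge0// rnorm_ge0.
  by rewrite expr2 ler_pM2r.
apply: ge_ereal_sup => _ [x /= x1 <-]; rewrite lee_fin.
set h := hdot (C x) x.
have x2 : rnorm x ^+ 2 <= 1 by rewrite expr_le1// rnorm_ge0.
have [->|h0] := eqVneq h 0; first by rewrite /rnorm normr0 /= ler01.
have nh0 : `|h| != 0 by rewrite normr_eq0.
apply: le_trans x2; rewrite -[X in X <= _](_ : L (h^-1 * `|h| *: x) x = _).
  by apply: L1; rewrite /rnorm normrM normfV normr_id mulVf.
rewrite LZ -CL -rdotZ /rdot linearZl_LR /= -/h /GRing.scale /=.
by rewrite mulrAC mulVf// mul1r.
Qed.

(** Real parts determine the adjoint: the imaginary part of <u, v> is
    - Re <i u, v>, and T commutes with i. *)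
Lemma adjointP (T : {linear H -> H}) (y z : H) :
  (forall x, rdot (T x) y = rdot x z) -> adjoint T y = z.
Proof.
move=> Tyz; have Tz x : hdot (T x) y = hdot x z.
  have ImE u v : complex.Im (hdot u v) = - rdot ('i%C *: u) v.
    rewrite /rdot linearZl_LR /=; case: (hdot u v) => a b /=.
    by rewrite mul0r mul1r sub0r opprK.
  apply/eqP; rewrite eq_complex; apply/andP; split; apply/eqP.
    exact: Tyz.
  by rewrite !ImE -linearZ Tyz.
apply: rdot_inj => x; rewrite ![rdot _ x]rdotC /rdot.
have := @getPex _ [set z : H | forall x, hdot (T x) y = hdot x z] (ex_intro _ z Tz).
by rewrite -/(adjoint T y) => /(_ x) <-; rewrite Tz.
Qed.

End FormOperators.

Section LimitForm.
Variables (R : realType) (H : hilbertType R) (S P : {linear H -> H}).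

(** The conditions in [num_form] are equations and non-strict inequalities
    between values of the form, so they survive the limit; [num_form_abs]
    supplies the boundedness that the limit needs, and the errors of the
    approximate solutions vanish in it. *)
Lemma limit_form : Gamma_contraction S P ->
  (forall x, rnorm (P x) <= rnorm x) ->
  exists2 L, num_form L & forall x y, L x y + L y (P x) = rdot (S x) y.
Proof.
move=> SP P1; have [e e0 elim] := exists_null_seq R.
have /boolp.choice[B BP] : forall n, exists B, num_form B /\
    forall x y, `|B x y + B y (P x) - rdot (S x) y| <=
                e n * (rnorm x ^+ 2 + rnorm y ^+ 2).
  by move=> n; have [B] := approximate_form SP P1 (e0 n); exists B.
have Bn n : num_form (B n) by case: (BP n).
have Bb x y : bounded_seq (fun n => B n x y).
  by exists (rnorm x ^+ 2 + rnorm y ^+ 2) => n; exact: num_form_abs.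
have [glim [glimD glimZ glim_le glim_lim]] := generalized_limit R.
exists (fun x y => glim (fun n => B n x y)).
  split=> [x y z|x y z|t x y|a x y|a x a1].
  - by rewrite -glimD//; congr glim; apply/funext => n; case: (Bn n).
  - by rewrite -glimD//; congr glim; apply/funext => n; case: (Bn n).
  - by rewrite -glimZ//; congr glim; apply/funext => n; case: (Bn n).
  - by congr glim; apply/funext => n; case: (Bn n).
  - by apply: glim_le => // n; case: (Bn n) => _ _ _ _; exact.
move=> x y; rewrite -glimD//; apply: glim_lim; apply/cvgrPdistC_lt => d d0.
have Z0 : 0 < rnorm x ^+ 2 + rnorm y ^+ 2 + 1.
  by rewrite ltr_wpDl// addr_ge0// sqr_ge0.
have [N eN] := elim _ (divr_gt0 d0 Z0).
exists N => // n /= /eN; rewrite ltr_pdivlMr// => en.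
have [_ /(_ x y) Bxy] := BP n; apply: (le_lt_trans Bxy).
by have := e0 n; lra.
Qed.

End LimitForm.

Unset Implicit Arguments.
Set Strict Implicit.
Set Printing Implicit Defensive.

Theorem mainTheorem4 (R : realType) (H : hilbertType R)
    (S P : {linear H -> H}) :
  separable H ->
  Gamma_contraction S P ->
  pure_contraction P ->
  exists C1 : {linear H -> H},
    [/\ bounded_op C1,
        (num_radius C1 <= 1)%E &
        forall x : H, S x = C1 x + adjoint C1 (P x)].
Proof.
move=> _ SP [P1 _].
have {}P1 x : rnorm (P x) <= rnorm x.
  by rewrite -[leRHS]mul1r; apply: (opnorm_le _ P1) => a y; exact: linearZ.
have [L Ln LSP] := limit_form SP P1.
have [C CL [Cb Cr]] := num_form_operator Ln.
exists C; split=> // x.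
(* The equation of [limit_form] at (x, w) is Re <S x - C x, w> = Re <C w, P x>. *)
have -> : adjoint C (P x) = S x - C x.
  apply: adjointP => w.
  by rewrite rdotDr rdotNr !(rdotC w) !CL -LSP addrC addKr.
by rewrite addrC subrK.
Qed.
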